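(* Let $p$ be a prime number, let $t$ be a positive integer, and let $q=p^t$. For integers $1\le i\le n$ let $e(n,i)=q^{\lceil\log_p(n/i)\rceil}$. Let $G$ be a group. Then for every $n\ge1$, \[ G_{(n,q)}=\prod_{i=1}^n(G^{(i,0)})^{e(n,i)}. \]
   Context: For a group $G$, the lower central filtration is $G^{(1,0)}=G$, $G^{(n+1,0)}=[G^{(n,0)},G]$ for $n\ge1$. The $q$-Zassenhaus filtration $G_{(n,q)}$, $n=1,2,\ldots$, of $G$ is defined inductively by \[ G_{(1,q)}=G,\qquad G_{(n,q)}=(G_{(\lceil n/p\rceil,q)})^q\prod_{s+t=n}[G_{(s,q)},G_{(t,q)}]\quad (n\ge2), \] where the product is over all integers $s,t\ge1$ with $s+t=n$ (here $t$ is a summation index, unrelated to the exponent in $q=p^t$). For a subgroup $H$ and an integer $a\ge0$, $H^a$ denotes the subgroup generated by all $a$-th powers of elements of $H$, and $[H,K]$ is the subgroup generated by all commutators of elements of $H$ with elements of $K$. *)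

(* Defs.v *)
From HB Require Import structures.
From mathcomp Require Import all_boot all_order all_algebra.
From mathcomp Require Import all_classical all_reals.
From mathcomp Require Import Rstruct exp.
Set Implicit Arguments.
Unset Strict Implicit.
Unset Printing Implicit Defensive.
Import Order.TTheory GRing.Theory Num.Theory.
Local Open Scope classical_set_scope.
Local Open Scope group_scope.
Local Open Scope nat_scope.

(* [groupType] is the library's type of arbitrary, possibly infinite,
   multiplicative groups; subsets are Prop-valued ([set G]). *)

Definition is_subgroup (G : groupType) (H : set G) : Prop :=
  [/\ H 1%g,
      forall x y, H x -> H y -> H (x * y)%g
    & forall x, H x -> H (x^-1)%g].

Definition subgroup_gen (G : groupType) (A : set G) : set G :=
  smallest (@is_subgroup G) A.

Definition commg_subgroup (G : groupType) (H K : set G) : set G :=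
  subgroup_gen [set [~ x, y]%g | x in H & y in K].

Definition powg_subgroup (G : groupType) (H : set G) (a : nat) : set G :=
  subgroup_gen [set (x ^+ a)%g | x in H].

Definition mulg_set (G : groupType) (A B : set G) : set G :=
  [set (x * y)%g | x in A & y in B].

(* Finite products of subsets are products of sets, taken in increasing order
   of the index: no subgroup generation is built in. *)
Notation "\mulg_ ( m <= i < n ) F" :=
  (\big[@mulg_set _/[set 1%g]]_(m <= i < n) F%classic)
  (at level 41, F at level 41, i, m, n at level 50,
   format "'[' \mulg_ ( m  <=  i  <  n ) '/  '  F ']'") : classical_set_scope.

(* Indexed from 1; the value at 0 is irrelevant. *)
Fixpoint lower_central (G : groupType) (n : nat) : set G :=
  match n with
  | 0 | 1 => setT
  | m.+1 => commg_subgroup (@lower_central G m) setT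
  end.
Arguments lower_central G n : clear implicits.

Definition ceil_div (n d : nat) : nat := (n + d.-1) %/ d.

(* Course-of-values recursion on n, with k as fuel: each index used on the
   right-hand side is smaller than n as soon as 1 < p, so k = n suffices.  See
   [zassenhaus1] and [zassenhausE]. *)
Fixpoint zassenhaus_rec (G : groupType) (p q k n : nat) : set G :=
  if k is k'.+1 then
    if n <= 1 then setT
    else mulg_set
           (powg_subgroup (@zassenhaus_rec G p q k' (ceil_div n p)) q)
           (\mulg_(1 <= s < n)
              commg_subgroup (@zassenhaus_rec G p q k' s)
                             (@zassenhaus_rec G p q k' (n - s)))%classic
  else setT.
Arguments zassenhaus_rec G p q k n : clear implicits.

Definition zassenhaus (G : groupType) (p q n : nat) : set G :=
  zassenhaus_rec G p q n n.
Arguments zassenhaus G p q n : clear implicits.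

Lemma ceil_div_lt (n p : nat) : 1 < p -> 1 < n -> ceil_div n p < n.
Proof.
case: p => [|[|p]] // _; case: n => [|[|n]] // _.
by rewrite /ceil_div ltn_divLR // mulnS ltn_add2l ltn_Pmull.
Qed.

Lemma zassenhaus_recE (G : groupType) (p q k n : nat) :
  1 < p -> n <= k -> zassenhaus_rec G p q k n = zassenhaus G p q n.
Proof.
move=> p1; rewrite /zassenhaus.
suff H : forall m k l, k <= m -> l <= m -> n <= k -> n <= l ->
    zassenhaus_rec G p q k n = zassenhaus_rec G p q l n.
  by move=> nk; apply: (H (maxn n k)); rewrite ?leq_maxl ?leq_maxr.
move=> m; elim: m n => [|m IH] n [|k'] [|l'] //= km lm nk nl.
- by rewrite (leq_trans nk).
- by rewrite (leq_trans nl).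
case: ltnP => // n1.
congr (mulg_set (powg_subgroup _ _) _).
  have := ceil_div_lt p1 n1 => c.
  by apply: IH => //; rewrite -ltnS; apply: leq_trans c _.
apply: eq_big_nat => s /andP[s0 sn].
have ns : n - s < n by rewrite ltn_subrL s0 (ltnW n1).
congr commg_subgroup; apply: IH => //; rewrite -ltnS.
- exact: leq_trans sn _.
- exact: leq_trans sn _.
- exact: leq_trans ns _.
- exact: leq_trans ns _.
Qed.

Lemma zassenhaus1 (G : groupType) (p q : nat) : zassenhaus G p q 1 = setT.
Proof. by []. Qed.

Lemma zassenhausE (G : groupType) (p q n : nat) : 1 < p -> 2 <= n ->
  zassenhaus G p q n =
  mulg_set (powg_subgroup (zassenhaus G p q (ceil_div n p)) q)
           (\mulg_(1 <= s < n) commg_subgroup (zassenhaus G p q s)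
                                              (zassenhaus G p q (n - s))).
Proof.
move=> p1; case: n => [|n] // n1; rewrite {1}/zassenhaus /= leqNgt n1 /=.
rewrite zassenhaus_recE //; last by rewrite -ltnS ceil_div_lt.
congr mulg_set; apply: eq_big_nat => s /andP[s0 sn].
rewrite !zassenhaus_recE //.
by rewrite -ltnS ltn_subrL s0.
Qed.

(* The ceiling of log_p x as a natural number, meaningful for x >= 1: there
   the ceiling is nonnegative, so [absz] does not change it. *)
Definition ceil_log (R : realType) (p : nat) (x : R) : nat :=
  absz (Num.ceil (ln x / ln (p%:R : R))%R).

(* The ambient real numbers are the concrete ones of the standard library. *)
Definition zexp (p q n i : nat) : nat :=
  q ^ @ceil_log Rdefinitions.R p (n%:R / i%:R)%R.

Lemma ceil_log_le (R : realType) (p n i k : nat) : 1 < p -> 0 < i <= n ->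
  (@ceil_log R p (n%:R / i%:R)%R <= k) = (n <= i * p ^ k).
Proof.
move=> p1 /andP[i0 lein].
have n0 : 0 < n by apply: leq_trans i0 lein.
have i0' : (0 < i%:R :> R)%R by rewrite ltr0n.
have lp : (0 < ln (p%:R : R))%R by apply: ln_gt0; rewrite ltr1n.
set x := (n%:R / i%:R)%R.
have x1 : (1 <= x)%R by rewrite /x ler_pdivlMr // mul1r ler_nat.
have c0 : (0 <= Num.ceil (ln x / ln (p%:R : R)))%R.
  rewrite ceil_ge0; apply: (@lt_le_trans _ _ 0%R).
    by rewrite oppr_lt0 ltr01.
  by apply: divr_ge0; [exact: ln_ge0 | exact: ltW].
rewrite /ceil_log -lez_nat gez0_abs // ceil_le_int.
rewrite ler_pdivrMr // -pmulrn mulr_natl -lnXn ?ltr0n ?(ltnW p1) //.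
rewrite ler_ln ?posrE; last 2 first.
- exact: lt_le_trans x1.
- by rewrite exprn_gt0 // ltr0n ltnW.
by rewrite /x ler_pdivrMr // -natrX -natrM ler_nat mulnC.
Qed.

Lemma zexpE (p q n i : nat) : 1 < p -> 0 < i <= n ->
  exists2 k, zexp p q n i = q ^ k &
    forall l, (k <= l) = (n <= i * p ^ l).
Proof.
move=> p1 lein; exists (@ceil_log Rdefinitions.R p (n%:R / i%:R)%R) => // l.
exact: ceil_log_le.
Qed.

(* Main.v *)
Require Import Defs.
From mathcomp Require Import all_boot all_order all_algebra.
From mathcomp Require Import all_classical.
From mathcomp Require Import zify.
Local Open Scope classical_set_scope.
Local Open Scope nat_scope.

(** Let [D n] be the subgroup generated by the powers [x ^+ (q ^ j)] with [x]
    in the [a]-th term of the lower central series and [n <= a * p ^ j].  The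
    ceiling of [log_p (n / i)] is the least [j] with [n <= i * p ^ j], so [D n]
    is the product on the right of the theorem.  An induction on [n] identifies
    it with the Zassenhaus filtration, as soon as [D] is known to satisfy
    [D m ^ q <= D (m * p)] and [[D m, D n] <= D (m + n)]
    ([lazard_series_qpow], [lazard_series_comm]).

    Both inclusions come from expanding a sequence in a group by binomial
    coefficients.  For a filtration [F], call [f : nat -> G] polynomial if its
    [i]-th iterated difference takes its values in [F i] for all [i].
    Polynomial sequences form a group ([poly_seq_group], the theorem of Lazard
    and Leibman), and each of them is a product of sequences
    [g_i ^+ 'C(n, i)] with [g_i] in [F i].  At [n = q ^ l] the exponent
    ['C(q ^ l, i)] is divisible by some [q ^ e] with [p ^ l <= i * p ^ e]
    ([qpow_bin_exponent]): what the power of [q] loses, the depth [i] of [g_i]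
    makes up for.

    Applied to [n |-> [~ z, y ^+ n]] this handles commutators, and applied to
    [n |-> (x ^+ n * y ^+ n)^-1 * (x * y) ^+ n] it shows that the elements of
    [D m] with [q]-th power in [D (m * p)] are closed under products.  To
    control the factors [g_i ^+ (q ^ e)], which are powers of arbitrary elements
    of some deeper [D s], everything is done modulo a fixed [D N], by downward
    induction on the depth ([truncated_lazard_series_closed]). *)

Set Implicit Arguments.
Unset Strict Implicit.

(** * Normal subgroups and commutators *)

Section Subgroups.
Context {G : groupType}.
Implicit Types (A B H K : set G) (x y z g : G).
Local Open Scope group_scope.

Lemma commMg_conj x y z : [~ x * y, z] = [~ x, z] ^ y * [~ y, z].
Proof. by rewrite /commg !conjgE !gnorm. Qed.

Lemma commgM_conj x y z : [~ x, y * z] = [~ x, z] * [~ x, y] ^ z.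
Proof. by rewrite /commg !conjgE !gnorm. Qed.

Lemma hall_witt_id x y z :
  [~ x, y^-1, z] ^ y * [~ y, z^-1, x] ^ z * [~ z, x^-1, y] ^ x = 1.
Proof. by rewrite /commg !conjgE !gnorm. Qed.

Lemma conjg_commg x g : x ^ g = x * [~ x, g].
Proof. by rewrite /commg mulVKg. Qed.

Lemma subgroupX H x n : is_subgroup H -> H x -> H (x ^+ n).
Proof. by case=> H1 HM _ Hx; elim: n => // n IH; rewrite expgS; apply: HM. Qed.

Lemma is_subgroup_gen A : is_subgroup (subgroup_gen A).
Proof.
split=> [|x y Ax Ay|x Ax] B [sB AB]; case: (sB) => B1 BM BV //.
- by apply: BM; [apply: Ax | apply: Ay].
- by apply: BV; apply: Ax.
Qed.

Lemma subset_gen A : A `<=` subgroup_gen A.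
Proof. exact: sub_gen_smallest. Qed.

Lemma gen_subset A H : is_subgroup H -> A `<=` H -> subgroup_gen A `<=` H.
Proof. exact: smallest_sub. Qed.

Definition is_normal H := is_subgroup H /\ forall x g, H x -> H (x ^ g).

Lemma normal_setT : is_normal setT.
Proof. by []. Qed.

Lemma normal_commg H x g : is_normal H -> H x -> H [~ x, g].
Proof. by case=> -[_ HM HV] HJ Hx; apply: HM; [apply: HV | apply: HJ]. Qed.

Lemma normal_commgr H x g : is_normal H -> H x -> H [~ g, x].
Proof.
move=> nH Hx; rewrite -invgR; case: (nH) => -[_ _ HV] _.
by apply: HV; apply: normal_commg.
Qed.

Lemma normal_gen A :
  (forall x g, A x -> A (x ^ g)) -> is_normal (subgroup_gen A).
Proof.
move=> AJ; split=> [|x g]; first exact: is_subgroup_gen.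
have [g1 gM gV] := is_subgroup_gen A.
apply: (@gen_subset A [set z | subgroup_gen A (z ^ g)]) => [|z Az] /=.
  split=> /= [|u v Au Av|u Au].
  - by rewrite conj1g.
  - by rewrite conjMg; apply: gM.
  - by rewrite conjVg; apply: gV.
by apply: subset_gen; apply: AJ.
Qed.

Lemma normal_commg_subgroup H K :
  is_normal H -> is_normal K -> is_normal (commg_subgroup H K).
Proof.
move=> [_ HJ] [_ KJ]; apply: normal_gen => _ g [x Hx [y Ky <-]].
by exists (x ^ g); [apply: HJ | exists (y ^ g); [apply: KJ | rewrite conjRg]].
Qed.

Lemma normal_powg_subgroup H a : is_normal H -> is_normal (powg_subgroup H a).
Proof.
move=> [_ HJ]; apply: normal_gen => _ g [x Hx <-].
by exists (x ^ g); [apply: HJ | rewrite conjXg].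
Qed.

(** The elements whose commutator with a fixed [y] lies in a normal subgroup
    form a subgroup, so commutator inclusions can be checked on generators. *)
Lemma gen_commg A H y : is_normal H -> (forall x, A x -> H [~ x, y]) ->
  forall x, subgroup_gen A x -> H [~ x, y].
Proof.
move=> [[H1 HM HV] HJ] AH x.
apply: (@gen_subset A [set z | H [~ z, y]]) => //; split=> /= [|u v Hu Hv|u Hu].
- by rewrite comm1g.
- by rewrite commMg_conj; apply: HM => //; apply: HJ.
- have -> : [~ u^-1, y] = ([~ u, y] ^ u^-1)^-1.
    by rewrite /commg !conjgE !gnorm.
  by apply: HV; apply: HJ.
Qed.

Lemma gen_commgr A H y : is_normal H -> (forall x, A x -> H [~ y, x]) ->
  forall x, subgroup_gen A x -> H [~ y, x].
Proof.
move=> nH AH x Ax; case: (nH) => -[_ _ HV] _; rewrite -invgR; apply: (HV).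
by apply: (gen_commg nH _ Ax) => u Au; rewrite -invgR; apply: HV; apply: AH.
Qed.

(** Normality lets the factors be reordered: [a b c d = a c^(b^-1) b d]. *)
Lemma normal_mulg_set A B :
  is_normal A -> is_normal B -> is_normal (mulg_set A B).
Proof.
move=> [[A1 AM AV] AJ] [[B1 BM BV] BJ]; split; first split.
- by exists 1 => //; exists 1 => //; rewrite mulg1.
- move=> _ _ [a Aa [b Bb <-]] [c Ac [d Bd <-]].
  exists (a * (c ^ b^-1)); first by apply: AM => //; apply: AJ.
  exists (b * d); first exact: BM.
  by rewrite !conjgE !gnorm.
- move=> _ [a Aa [b Bb <-]].
  exists (a^-1 ^ b); first by apply: AJ; apply: AV.
  exists b^-1; first exact: BV.
  by rewrite !conjgE !gnorm.
- move=> _ g [a Aa [b Bb <-]].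
  by exists (a ^ g); [apply: AJ | exists (b ^ g); [apply: BJ | rewrite conjMg]].
Qed.

Lemma normal_prod (r : seq nat) (F : nat -> set G) :
  {in r, forall i, is_normal (F i)} ->
  is_normal (\big[@mulg_set _/[set 1]]_(i <- r) F i).
Proof.
elim: r => [|i s IH] nF.
  rewrite big_nil; split=> [|x g ->]; last by rewrite conj1g.
  by split=> [|x y -> ->|x ->] //=; rewrite ?mulg1 ?invg1.
rewrite big_cons; apply: normal_mulg_set; first by apply: nF; rewrite mem_head.
by apply: IH => j js; apply: nF; rewrite in_cons js orbT.
Qed.

Lemma subset_prod (r : seq nat) (F : nat -> set G) i :
  {in r, forall i, is_normal (F i)} -> i \in r ->
  F i `<=` \big[@mulg_set _/[set 1]]_(i <- r) F i.
Proof.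
elim: r => [|j s IH] // nF.
have ns : {in s, forall i, is_normal (F i)}.
  by move=> k ks; apply: nF; rewrite in_cons ks orbT.
rewrite in_cons big_cons => /predU1P[->|/(IH ns) sub] x Fx.
  exists x => //; exists 1; last by rewrite mulg1.
  by case: (normal_prod ns) => -[].
exists 1; first by case: (nF j (mem_head _ _)) => -[].
by exists x; [apply: sub | rewrite mul1g].
Qed.

Lemma prod_subset (r : seq nat) (F : nat -> set G) H :
  is_subgroup H -> {in r, forall i, F i `<=` H} ->
  \big[@mulg_set _/[set 1]]_(i <- r) F i `<=` H.
Proof.
move=> [H1 HM _]; elim: r => [|j s IH] FH; first by rewrite big_nil => x ->.
rewrite big_cons => _ [x Fx [y Fy <-]]; apply: HM.
  by apply: FH Fx; rewrite mem_head.
by apply: IH Fy => k ks; apply: FH; rewrite in_cons ks orbT.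
Qed.

End Subgroups.

(** * The lower central series *)

Section LowerCentral.
Context {G : groupType}.
Implicit Types (x y z g : G).
Local Open Scope group_scope.
Local Notation gamma := (lower_central G).

Lemma lower_centralS i : gamma i.+2 = commg_subgroup (gamma i.+1) setT.
Proof. by []. Qed.

Lemma normal_lower_central i : is_normal (gamma i).
Proof.
case: i => [|i]; first exact: normal_setT.
elim: i => [|i IH]; first exact: normal_setT.
by rewrite lower_centralS; apply: normal_commg_subgroup IH normal_setT.
Qed.

Lemma lower_central_commg i x g : gamma i x -> gamma i.+1 [~ x, g].
Proof.
case: i => [|i] // Hx; rewrite lower_centralS.
by apply: subset_gen; exists x => //; exists g.
Qed.

Lemma lower_central_antimono i j : i <= j -> gamma j `<=` gamma i.
Proof.
move=> /subnKC <-; elim: (j - i) => [|k IH]; first by rewrite addn0.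
rewrite addnS; apply: subset_trans IH.
case: (i + k) => [|m] //; rewrite lower_centralS; apply: gen_subset.
  by case: (normal_lower_central m.+1).
by move=> _ [x Hx [y _ <-]]; apply: normal_commg Hx; apply: normal_lower_central.
Qed.

(** Induction on [j]: for a generator [[~ y, g]] of the next term, the Hall-Witt
    identity expresses [[~ y, g, x]] through [[~ x, y^-1, g^-1]] and
    [[~ g^-1, x^-1, y]], to which the previous stage applies, at [i] and at
    [i.+1]. *)
Lemma lower_central_comm i j x y :
  gamma i x -> gamma j y -> gamma (i + j) [~ x, y].
Proof.
case: j => [|j].
  by rewrite addn0 => Hx _; apply: normal_commg Hx; apply: normal_lower_central.
elim: j => [|j IH] in i x y *.
  by rewrite addn1 => + _; apply: lower_central_commg.
move=> Hx; apply: gen_commgr (normal_lower_central _) _ y => _ [y Hy [g _ <-]].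
have [[_ HM HV] HJ] := normal_lower_central (i + j.+2).
have [[_ _ xV] _] := normal_lower_central i.
have [[_ _ yV] _] := normal_lower_central j.+1.
have [[_ _ xgV] _] := normal_lower_central i.+1.
rewrite -invgR; apply: (HV).
set w := [~ y, g, x].
have -> : w = ([~ x, y^-1, g^-1] ^ y) ^-1 ^ g * ([~ g^-1, x^-1, y] ^ x) ^-1 ^ g.
  have := hall_witt_id x y g^-1; rewrite invgK -/w => E.
  have {}E : w ^ g^-1 = ([~ x, y^-1, g^-1] ^ y)^-1 * ([~ g^-1, x^-1, y] ^ x)^-1.
    apply: (mulgI ([~ x, y^-1, g^-1] ^ y)); rewrite mulVKg.
    by apply: (mulIg ([~ g^-1, x^-1, y] ^ x)); rewrite mulVg E.
  by rewrite -conjMg -E -conjgM mulVg conjg1.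
apply: HM; apply: (HJ); apply: (HV); apply: HJ.
  rewrite addnS; apply: lower_central_commg; apply: IH => //; exact: yV.
rewrite addnS -addSn; apply: IH => //.
by rewrite -invgR; apply: xgV; apply: lower_central_commg; apply: xV.
Qed.

End LowerCentral.

(** * Polynomial sequences in a filtered group *)

Section PolynomialSequences.
Context {G : groupType}.
Implicit Types (F : nat -> set G) (K : set G) (x y z g : G) (f : nat -> G).
Local Open Scope group_scope.

(** [F 0] may be a proper subgroup: the filtrations that serve to expand
    [[~ z, y ^+ n]] start at the term of a series to which [z] belongs. *)
Record filtration F : Prop := {
  filtration_subgroup i : is_subgroup (F i);
  filtrationS i : F i.+1 `<=` F i;
  filtration_comm i j x y : F i x -> F j y -> F (i + j) [~ x, y] }.

Definition seq_diff f n := (f n)^-1 * f n.+1.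

(** [poly_seq F N k f]: for [i <= N], the [i]-th difference of [f] takes its
    values in [F (k + i)].  The group property is proved by induction on the
    bound [N]; the shift [k] records the depth of [f] itself. *)
Fixpoint poly_seq F N k f : Prop :=
  (forall n, F k (f n)) /\
  if N is M.+1 then poly_seq F M k.+1 (seq_diff f) else True.

Section Group.
Variables (F : nat -> set G) (filF : filtration F).

Let F1 i : F i 1. Proof. by case: (filtration_subgroup filF i). Qed.
Let FM i x y : F i x -> F i y -> F i (x * y).
Proof. by case: (filtration_subgroup filF i) => _ + _; apply. Qed.
Let FV i x : F i x -> F i x^-1.
Proof. by case: (filtration_subgroup filF i) => _ _; apply. Qed.

Lemma filtration_antimono i j : i <= j -> F j `<=` F i.
Proof.
move=> /subnKC <-; elim: (j - i) => [|k IH]; first by rewrite addn0.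
by rewrite addnS; apply: subset_trans IH; apply: filtrationS.
Qed.

Lemma poly_seq_val N k f : poly_seq F N k f -> forall n, F k (f n).
Proof. by case: N => [|N] []. Qed.

Lemma poly_seq_shift N j k f : j <= k -> poly_seq F N k f -> poly_seq F N j f.
Proof.
elim: N j k f => [|N IH] j k f jk /= [Ff df]; split=> //.
- by move=> n; apply: filtration_antimono (Ff n).
- by move=> n; apply: filtration_antimono (Ff n).
- by apply: IH df.
Qed.

Lemma poly_seqW N k f : poly_seq F N.+1 k f -> poly_seq F N k f.
Proof.
elim: N k f => [|N IH] k f; first by case.
by move=> [Ff df]; split => //; apply: IH.
Qed.

(** The differences of [f g], [f^-1] and [[~ f, g]] are products of conjugates
    and commutators that involve [seq_diff f] or [seq_diff g], hence lie one
    level deeper, with one difference fewer to control.  Products need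
    commutators and conversely, so the three closure properties go through the
    same induction. *)
Lemma poly_seq_group N :
  [/\ forall k (f g : nat -> G), poly_seq F N k f -> poly_seq F N k g ->
        poly_seq F N k (fun n => f n * g n),
      forall k f, poly_seq F N k f -> poly_seq F N k (fun n => (f n)^-1)
    & forall j k (f g : nat -> G), poly_seq F N j f -> poly_seq F N k g ->
        poly_seq F N (j + k) (fun n => [~ f n, g n])].
Proof.
elim: N => [|N [IHM IHV IHR]].
  split=> [k f g [Ff _] [Fg _]|k f [Ff _]|j k f g [Ff _] [Fg _]]; split=> // n.
  - exact: FM.
  - exact: FV.
  - exact: filtration_comm.
have IHJ k j (f g : nat -> G) : poly_seq F N k f -> poly_seq F N j g ->
    poly_seq F N k (fun n => f n ^ g n).
  move=> pf pg; rewrite (_ : (fun n => _) = fun n => f n * [~ f n, g n]).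
    apply: IHM => //; apply: poly_seq_shift (IHR _ _ _ _ pf pg).
    exact: leq_addr.
  by apply/funext => n; rewrite conjg_commg.
split.
- move=> k f g [Ff df] [Fg dg]; split=> [n|]; first exact: FM.
  have pg : poly_seq F N k g by apply: poly_seqW; split.
  have -> : seq_diff (fun n => f n * g n) =
      fun n => (seq_diff f n ^ g n) * seq_diff g n.
    by apply/funext => n; rewrite /seq_diff !conjgE !gnorm.
  by apply: IHM dg; apply: IHJ df pg.
- move=> k f [Ff df]; split=> [n|]; first exact: FV.
  have pf : poly_seq F N k f by apply: poly_seqW; split.
  have -> : seq_diff (fun n => (f n)^-1) =
      fun n => ((seq_diff f n) ^-1) ^ ((f n)^-1).
    by apply/funext => n; rewrite /seq_diff !conjgE !gnorm.
  by apply: IHJ (IHV _ _ df) (IHV _ _ pf).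
- move=> j k f g [Ff df] [Fg dg]; split=> [n|]; first exact: filtration_comm.
  have pf : poly_seq F N j f by apply: poly_seqW; split.
  have pg : poly_seq F N k g by apply: poly_seqW; split.
  set a := seq_diff f in df; set b := seq_diff g in dg.
  pose X n := [~ f n, g n].
  have pX : poly_seq F N (j + k) X by apply: IHR.
  (* [X n]^-1 [f a, g b], expanded by the commutator identities: the factor
     [X n] cancels up to a commutator with [b n * a n]. *)
  have -> : seq_diff X = fun n =>
     ([~ f n, b n] ^ a n) ^ X n * [~ X n, b n * a n] * [~ a n, g n * b n].
    apply/funext => n; rewrite /seq_diff.
    have -> : X n.+1 = [~ f n * a n, g n * b n].
      by rewrite /X /a /b /seq_diff !mulVKg.
    rewrite commMg_conj commgM_conj conjMg -/(X n) /commg.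
    by rewrite !(conjgE, gnorm).
  apply: (IHM); first apply: (IHM).
  + by apply: (IHJ) pX; apply: (IHJ) df; rewrite -addnS; apply: IHR.
  + rewrite -addn1; apply: IHR => //; apply: IHM.
      by apply: poly_seq_shift dg.
    by apply: poly_seq_shift df.
  + rewrite -addSn; apply: IHR => //; apply: IHM => //.
    by apply: poly_seq_shift dg.
Qed.

Lemma poly_seqM N k (f g : nat -> G) : poly_seq F N k f -> poly_seq F N k g ->
  poly_seq F N k (fun n => f n * g n).
Proof. by case: (poly_seq_group N) => + _ _; apply. Qed.

Lemma poly_seqV N k f : poly_seq F N k f -> poly_seq F N k (fun n => (f n)^-1).
Proof. by case: (poly_seq_group N) => _ + _; apply. Qed.

(** Pascal's rule: the difference of [n |-> 'C(n, i.+1)] is [n |-> 'C(n, i)]. *)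
Lemma poly_seq_bin N k i x : F (k + i) x ->
  poly_seq F N k (fun n => x ^+ 'C(n, i)).
Proof.
have V k' i' y : F (k' + i') y -> forall n, F k' (y ^+ 'C(n, i')).
  move=> Fy n; apply: subgroupX; first exact: filtration_subgroup.
  by apply: filtration_antimono Fy; apply: leq_addr.
elim: N k i x => [|N IH] k i x Fx; first by split => //; apply: V.
split; first exact: V.
case: i Fx => [|i] Fx.
  have -> : seq_diff (fun n => x ^+ 'C(n, 0)) = fun n => 1 ^+ 'C(n, 0).
    by apply/funext => n; rewrite /seq_diff !bin0 mulVg expg1.
  by apply: IH; apply: F1.
have -> : seq_diff (fun n => x ^+ 'C(n, i.+1)) = fun n => x ^+ 'C(n, i).
  by apply/funext => n; rewrite /seq_diff binS expgnDr mulKg.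
by apply: IH; rewrite addSn -addnS.
Qed.

Lemma poly_seq_const N k x : F k x -> poly_seq F N k (fun=> x).
Proof.
move=> Fx; have -> : (fun=> x) = (fun n => x ^+ 'C(n, 0)).
  by apply/funext => n; rewrite bin0.
by apply: poly_seq_bin; rewrite addn0.
Qed.

Lemma poly_seq_expg N x : F 1%N x -> poly_seq F N 0 (fun n => x ^+ n).
Proof.
move=> Fx; have -> : (fun n => x ^+ n) = (fun n => x ^+ 'C(n, 1)).
  by apply/funext => n; rewrite bin1.
exact: poly_seq_bin.
Qed.

(** The difference of [n |-> z ^ (y ^+ n)] is the sequence of the same form that
    starts at [[~ z, y]].  Only the action of [y] on [F] matters: [y] itself
    may lie outside every [F i]. *)
Lemma poly_seq_orbit y N k z :
  (forall i x, F i x -> F i.+1 [~ x, y]) -> F k z ->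
  poly_seq F N k (fun n => z ^ (y ^+ n)).
Proof.
move=> Fy; have V k' x : F k' x -> forall n, F k' (x ^ (y ^+ n)).
  move=> Fx n; elim: n => [|n IH]; first by rewrite conjg1.
  rewrite expgSr conjgM conjg_commg; apply: FM => //.
  by apply: (filtrationS filF); apply: Fy.
elim: N k z => [|N IH] k z Fz; split=> //; try exact: V.
have -> : seq_diff (fun n => z ^ (y ^+ n)) = fun n => [~ z, y] ^ (y ^+ n).
  by apply/funext => n; rewrite /seq_diff expgS conjgM -conjVg -conjMg.
by apply: IH; apply: Fy.
Qed.

(** If [f] vanishes below [i], its [i]-th difference at [0] is [f i]. *)
Lemma poly_seq_lead k f i :
  (forall N, poly_seq F N k f) -> (forall j, j < i -> f j = 1) ->
  F (k + i) (f i).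
Proof.
elim: i k f => [|i IH] k f pf f1.
  by rewrite addn0; apply: (poly_seq_val (pf 0%N)).
have -> : f i.+1 = seq_diff f i by rewrite /seq_diff (f1 i) // invg1 mul1g.
rewrite -addSnnS; apply: IH => [N|j ji]; first by case: (pf N.+1).
by rewrite /seq_diff !f1 ?invg1 ?mul1g // ltnW.
Qed.

(** Newton expansion of [f]: peeling off [f i0 ^+ 'C(n, i0)] leaves a polynomial
    sequence that vanishes up to [i0]; once [i0] exceeds [m] nothing is left. *)
Lemma poly_seq_value K m i0 f : is_subgroup K ->
    (forall N, poly_seq F N 0 f) -> (forall i, i < i0 -> f i = 1) ->
    (forall i x, i0 <= i -> F i x -> K (x ^+ 'C(m, i))) ->
  K (f m).
Proof.
move=> [K1 KM KV].
have [d] := ubnP (m.+1 - i0); elim: d i0 f => // d IH i0 f le_d pf f1 Kbin.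
have [lt_m|le_m] := ltnP m i0; first by rewrite f1.
pose c := f i0; have Fc : F i0 c by apply: (poly_seq_lead pf f1).
have -> : f m = c ^+ 'C(m, i0) * ((c ^+ 'C(m, i0))^-1 * f m) by rewrite mulVKg.
apply: KM; first exact: Kbin.
apply: (IH i0.+1 (fun n => (c ^+ 'C(n, i0))^-1 * f n)) => [|N|i|i x lt_i].
- by move: le_d le_m; lia.
- by apply: poly_seqM => //; apply: poly_seqV; apply: poly_seq_bin.
- rewrite ltnS leq_eqVlt => /predU1P[->|lt_i]; first by rewrite binn mulVg.
  by rewrite bin_small // invg1 mul1g f1.
- by apply: Kbin; apply: ltnW.
Qed.

End Group.

End PolynomialSequences.

(** * Values at powers of [q] *)

Section Binomials.
Context (p t : nat) (p_prime : prime p) (t_gt0 : 0 < t).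
Let q := p ^ t.

(** Let [v] be the [p]-adic valuation of [i].  By the identity
    [i * 'C(n, i) = n * 'C(n.-1, i.-1)], that of ['C(q ^ l, i)] is at least
    [t * l - v], hence at least [t * (l - v)]. *)
Lemma qpow_dvd_bin l i : 0 < i -> q ^ (l - logn p i) %| 'C(q ^ l, i).
Proof.
move=> i0; have [->//|C0] := posnP 'C(q ^ l, i).
have [le_lv|lt_vl] := leqP l (logn p i).
  by move: le_lv; rewrite -subn_eq0 => /eqP ->; rewrite dvd1n.
rewrite -expnM pfactor_dvdn //.
have := mul_bin_diag (q ^ l) i.-1; rewrite prednK // => E.
have : 0 < q ^ l * 'C((q ^ l).-1, i.-1) by rewrite E muln_gt0 i0.
rewrite muln_gt0 => /andP[ql0 B0].
move/(congr1 (logn p)): E; rewrite !lognM // -expnM pfactorK //.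
by move: lt_vl t_gt0; nia.
Qed.

Lemma qpow_bin_exponent l i : 0 < i ->
  exists2 e, q ^ e %| 'C(q ^ l, i) & p ^ l <= i * p ^ e.
Proof.
move=> i0; exists (l - logn p i); first exact: qpow_dvd_bin.
have le_vi : p ^ logn p i <= i by rewrite dvdn_leq // pfactor_dvdnn.
apply: (@leq_trans (p ^ logn p i * p ^ (l - logn p i))); last first.
  by rewrite leq_mul2r le_vi orbT.
by rewrite -expnD leq_exp2l ?prime_gt1 //; lia.
Qed.

End Binomials.

Section Powers.
Context (p t : nat) (p_prime : prime p) (t_gt0 : 0 < t) {G : groupType}.
Implicit Types (F : nat -> set G) (K : set G) (x y z g : G).
Local Notation q := (p ^ t)%N.
Local Open Scope group_scope.

(** The condition on [K] is the form in which the trade-off between the depth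
    [i] and the exponent [q ^ e] enters all the applications. *)
Lemma qpow_bin_closed F K l i x : is_subgroup K -> 0 < i ->
    (forall e, (p ^ l <= i * p ^ e)%N -> F i x -> K (x ^+ (q ^ e)%N)) ->
  F i x -> K (x ^+ 'C((q ^ l)%N, i)).
Proof.
move=> sK i0 HK Fx.
have [e /dvdnP[c ->] le_e] := qpow_bin_exponent p_prime t_gt0 l i0.
by rewrite mulnC expgnA; apply: subgroupX => //; apply: HK.
Qed.

(** [n |-> [~ z, y ^+ n]] is the quotient of the orbit [z ^ (y ^+ n)] by the
    constant [z], and it vanishes at [0]. *)
Lemma commg_qpow F K l y z : filtration F -> is_subgroup K ->
    (forall i x, F i x -> F i.+1 [~ x, y]) ->
    (forall i e x, 0 < i -> (p ^ l <= i * p ^ e)%N -> F i x ->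
       K (x ^+ (q ^ e)%N)) ->
  F 0 z -> K [~ z, y ^+ (q ^ l)%N].
Proof.
move=> filF sK Fy HK Fz.
apply: (@poly_seq_value G F filF K (q ^ l)%N 1 (fun n => [~ z, y ^+ n])) => //.
- move=> N; apply: (poly_seqM filF); last exact: poly_seq_orbit.
  apply: (poly_seq_const filF); case: (filtration_subgroup filF 0%N) => _ _.
  by apply.
- by case=> // _; rewrite expg0 commg1.
- by move=> i x i0; apply: qpow_bin_closed => // e; apply: HK.
Qed.

(** [n |-> (x ^+ n * y ^+ n)^-1 * (x * y) ^+ n] vanishes at [0] and [1], so only
    terms of depth at least [2] occur: this is the Hall-Petrescu formula. *)
Lemma mulg_qpow F K x y : filtration F -> is_subgroup K ->
    (forall i e z, 1 < i -> (p <= i * p ^ e)%N -> F i z ->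
       K (z ^+ (q ^ e)%N)) ->
    F 1%N x -> F 1%N y -> K (x ^+ q) -> K (y ^+ q) -> K ((x * y) ^+ q).
Proof.
move=> filF sK HK Fx Fy Kx Ky; have [K1 KM KV] := sK.
have [_ FM _] := filtration_subgroup filF 1%N.
rewrite -[_ ^+ q](mulVKg (x ^+ q * y ^+ q)); apply: (KM); first exact: KM.
pose f n := (x ^+ n * y ^+ n)^-1 * (x * y) ^+ n.
rewrite -[q]expn1 -/(f _).
apply: (@poly_seq_value G F filF K (q ^ 1)%N 2 f) => //.
- move=> N; apply: (poly_seqM filF); last by apply: (poly_seq_expg filF); apply: FM.
  by apply: (poly_seqV filF); apply: (poly_seqM filF); apply: (poly_seq_expg filF).
- case=> [|[|]] // _; rewrite /f ?expg0 ?expg1 ?mulVg //.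
  by rewrite !gsimp.
- move=> i z i2; apply: qpow_bin_closed => //; first exact: ltnW.
  by move=> e; rewrite expn1; apply: HK.
Qed.

End Powers.

(** * The series generated by powers of the lower central series *)

Section LazardSeries.
Context (p t : nat) (p_prime : prime p) (t_gt0 : 0 < t) {G : groupType}.
Implicit Types (F : nat -> set G) (K : set G) (x y z g : G).
Local Notation q := (p ^ t)%N.
Local Notation gamma := (lower_central G).
Local Open Scope group_scope.

(** The right-hand side of the theorem without logarithms: [j] may be any
    exponent with [n <= a * p ^ j], since beyond the least one the generators
    are powers of earlier ones. *)
Definition lazard_series n : set G :=
  subgroup_gen [set x | exists a j y,
    [/\ 0 < a, (n <= a * p ^ j)%N, gamma a y & x = y ^+ (q ^ j)%N]].

Lemma lazard_series_pow n a j x : 0 < a -> (n <= a * p ^ j)%N -> gamma a x ->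
  lazard_series n (x ^+ (q ^ j)%N).
Proof. by move=> a0 le_n gx; apply: subset_gen; exists a, j, x. Qed.

Lemma lazard_series_antimono m n : m <= n ->
  lazard_series n `<=` lazard_series m.
Proof.
move=> le_mn; apply: gen_subset; first exact: is_subgroup_gen.
move=> _ [a [j [x [a0 le_n gx ->]]]].
exact: lazard_series_pow (leq_trans le_mn le_n) gx.
Qed.

Lemma normal_lazard_series n : is_normal (lazard_series n).
Proof.
apply: normal_gen => _ g [a [j [x [a0 le_n gx ->]]]].
exists a, j, (x ^ g); split => //; last by rewrite conjXg.
by case: (@normal_lower_central G a) => _ gJ; apply: gJ.
Qed.

(** Normality takes care of commutators with an element of [F 0]; this matters
    when the commutator inclusions are known at positive depth only. *)
Lemma filtration_normal F : (forall i, is_normal (F i)) ->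
    (forall i, F i.+1 `<=` F i) ->
    (forall i j x y, 0 < i -> 0 < j -> F i x -> F j y -> F (i + j) [~ x, y]) ->
  filtration F.
Proof.
move=> nF FS FC; split=> [i|//|[|i] [|j] x y Fx Fy]; first by case: (nF i).
- exact: normal_commg.
- exact: normal_commgr.
- by rewrite addn0; apply: normal_commg.
- exact: FC.
Qed.

(** For a generator [y ^+ (q ^ l)] with [y] of depth [a], the coefficients of
    [n |-> [~ x, y ^+ n]] have depth [b + a * i] in the lower central series,
    and [b + a * p ^ l <= (b + a * i) * p ^ e] when [p ^ l <= i * p ^ e]. *)
Lemma lazard_series_comm_lower_central b s x y : 0 < b ->
  gamma b x -> lazard_series s y -> lazard_series (b + s) [~ x, y].
Proof.
move=> b0 gx; apply: gen_commgr; first exact: normal_lazard_series.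
move=> _ [a [l [{}y [a0 le_s gy ->]]]].
pose F i := gamma (b + a * i).
have filF : filtration F.
  apply: filtration_normal => [i|i|i j u v _ _ Fu Fv].
  - exact: normal_lower_central.
  - by apply: lower_central_antimono; rewrite leq_add2l leq_mul2l leqnSn orbT.
  - apply: lower_central_antimono (lower_central_comm Fu Fv).
    by rewrite mulnDr; lia.
apply: (commg_qpow p_prime t_gt0 filF) => [|i u Fu|i e u i0 le_e Fu|].
- by case: (normal_lazard_series (b + s)).
- by rewrite /F mulnSr addnA; apply: lower_central_comm.
- apply: lazard_series_pow Fu; first by rewrite ltn_addr.
  have pe : (0 < p ^ e)%N by rewrite expn_gt0 prime_gt0.
  by move: (leq_mul2l a (p ^ l)%N (i * p ^ e)%N); rewrite le_e orbT; nia.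
- by rewrite /F muln0 addn0.
Qed.

(** ** Power and commutator inclusions *)

Section Truncation.
Variable N : nat.
(** Stopping the series at [N] gives the downward induction a starting point. *)
Let D s : set G := lazard_series (minn s N).

Let nD s : is_normal (D s). Proof. exact: normal_lazard_series. Qed.

Let D_antimono s r : s <= r -> D r `<=` D s.
Proof. by move=> le_sr; apply: lazard_series_antimono; lia. Qed.

Let D_top s r : N <= r -> D r `<=` D s.
Proof. by move=> le_sr; apply: lazard_series_antimono; lia. Qed.

(** Downward induction on [m]; from [N] on, [D] is constant.  Commutators of
    [D m] with a generator [y ^+ (q ^ l)], for [y] of depth [b], involve coefficients
    in [D (m + b * i)] with [i > 0], and [q]-th powers of products in [D m]
    involve coefficients in [D (m * i)] with [i > 1]: both are deeper than [m],
    where powers are already under control. *)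
Lemma truncated_lazard_series_closed m : 0 < m ->
  (forall s x, m <= s -> D s x -> D (s * p) (x ^+ q)) /\
  (forall s r x y, m <= s -> D s x -> D r y -> D (s + r) [~ x, y]).
Proof.
have [k] := ubnP (N - m); elim: k m => // k IH m le_k m0.
have [le_Nm|lt_mN] := leqP N m.
  split=> [s x le_ms Dx|s r x y le_ms Dx _].
    have [sD _] := nD (s * p); apply: (subgroupX q sD).
    by apply: D_top Dx; apply: leq_trans le_ms.
  apply: (normal_commg y (nD (s + r))); apply: D_top Dx; exact: leq_trans le_ms.
have [IHq IHc] : _ /\ _ := IH m.+1 ltac:(lia) isT.
have p_gt0 e : (0 < p ^ e)%N by rewrite expn_gt0 prime_gt0.
have IHqe e s x : m < s -> D s x -> D (s * p ^ e)%N (x ^+ (q ^ e)%N).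
  move=> lt_ms Dx; elim: e => [|e IHe]; first by rewrite !expn0 muln1.
  rewrite !expnSr mulnA expgnA; apply: IHq IHe.
  by apply: leq_trans lt_ms _; rewrite leq_pmulr.
have comm_m r x y : D m x -> D r y -> D (m + r) [~ x, y].
  move=> Dx; apply: (gen_commgr (nD (m + r))) => _ [b [l [{}y [b0 le_r gy ->]]]].
  pose F i := D (m + b * i).
  have filF : filtration F.
    apply: filtration_normal => [i|i|i j u v i0 j0 Fu Fv].
      exact: nD.
      by apply: (@D_antimono (m + b * i)); rewrite leq_add2l leq_mul2l leqnSn orbT.
    apply: (@D_antimono _ _ _ _ (IHc _ _ _ _ _ Fu Fv)).
      by rewrite mulnDr; lia.
    by rewrite -addn1 leq_add2l muln_gt0 b0.
  apply: (commg_qpow p_prime t_gt0 filF) => [|i u Fu|i e u i0 le_e Fu|].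
  - by case: (nD (m + r)).
  - rewrite -invgR; case: (nD (m + b * i.+1)) => -[_ _ DV] _; apply: DV.
    apply: lazard_series_antimono (lazard_series_comm_lower_central b0 gy Fu).
    by rewrite mulnSr; lia.
  - apply: lazard_series_antimono (IHqe e _ _ _ Fu); last first.
      by rewrite -addn1 leq_add2l muln_gt0 b0.
    have := p_gt0 e; move: (leq_mul2l b (p ^ l) (i * p ^ e)).
    by rewrite le_e orbT; nia.
  - by rewrite /F muln0 addn0.
have comm s r x y : m <= s -> D s x -> D r y -> D (s + r) [~ x, y].
  by rewrite leq_eqVlt => /predU1P[<-|lt_ms]; [apply: comm_m | apply: IHc].
split=> [s x|//].
rewrite leq_eqVlt => /predU1P[<-|]; last exact: IHq.
pose F i := D (m * i).
have filF : filtration F.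
  apply: filtration_normal => [i|i|i j u v i0 j0 Fu Fv].
      exact: nD.
    by apply: (@D_antimono (m * i)); rewrite leq_mul2l leqnSn orbT.
  by rewrite /F mulnDr; apply: comm Fu Fv; rewrite leq_pmulr.
have [[D1 DM DV] _] := nD m; have [[E1 EM EV] _] := nD (m * p).
pose Q := [set z | D m z /\ D (m * p) (z ^+ q)].
suff /(_ x) sub : D m `<=` Q by move=> /sub [].
apply: gen_subset => [|_ [a [l [y [a0 le_m gy ->]]]]].
  split=> [|u v [Du Eu] [Dv Ev]|u [Du Eu]]; split=> //.
  - by rewrite expg1n.
  - exact: DM.
  - apply: (mulg_qpow (K := D (m * p)) p_prime t_gt0 filF) => //;
      try by rewrite /F muln1.
    move=> i e z i1 le_p Fz.
    apply: (@D_antimono _ _ _ _ (IHqe e _ _ _ Fz)).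
      by rewrite -mulnA leq_mul2l le_p orbT.
    by rewrite -{1}(muln1 m) ltn_pmul2l.
  - exact: DV.
  - by rewrite expVgn; apply: EV.
split; first exact: lazard_series_pow le_m gy.
rewrite -expgnA -expnSr; apply: lazard_series_pow gy => //.
by rewrite expnSr; have := prime_gt0 p_prime; nia.
Qed.

End Truncation.

Lemma lazard_series_qpow m x : 0 < m ->
  lazard_series m x -> lazard_series (m * p) (x ^+ q).
Proof.
move=> m0; have [+ _] := truncated_lazard_series_closed (m * p) m0.
move=> /(_ m x (leqnn m)); rewrite minnn (minn_idPl _) //.
by rewrite leq_pmulr // prime_gt0.
Qed.

Lemma lazard_series_comm m n x y : 0 < m ->
  lazard_series m x -> lazard_series n y -> lazard_series (m + n) [~ x, y].
Proof.
move=> m0; have [_ +] := truncated_lazard_series_closed (m + n) m0.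
move=> /(_ m n x y (leqnn m)); rewrite minnn !(minn_idPl _) //.
  exact: leq_addl.
exact: leq_addr.
Qed.

Lemma lower_central_subset_lazard_series n : 0 < n ->
  gamma n `<=` lazard_series n.
Proof.
move=> n0 x gx; rewrite -[x]expg1 -(expn0 q).
by apply: lazard_series_pow gx; rewrite // muln1.
Qed.

(** ** Comparison with the two sides of the theorem *)

Lemma zassenhaus_eq_lazard_series n : 0 < n ->
  zassenhaus G p q n = lazard_series n.
Proof.
have p1 := prime_gt1 p_prime; have p0 := prime_gt0 p_prime.
have ceil_le k : (k <= ceil_div k p * p)%N.
  rewrite /ceil_div; have := divn_eq (k + p.-1) p.
  have := ltn_pmod (k + p.-1) p0; lia.
have [k] := ubnP n; elim: k n => // k IH [|[|n]] // lt_nk _.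
  rewrite zassenhaus1; apply/seteqP; split=> // x _.
  exact: lower_central_subset_lazard_series.
set m := ceil_div n.+2 p; have lt_m : m < n.+2 by apply: ceil_div_lt.
have m0 : 0 < m by have := ceil_le n.+2; rewrite -/m; case: (m).
rewrite zassenhausE // -/m (IH m) //; last exact: leq_trans lt_m _.
rewrite (@eq_big_nat _ _ _ 1 n.+2 _
  (fun s => commg_subgroup (lazard_series s) (lazard_series (n.+2 - s)))); last first.
  by move=> s /andP[s0 s_lt]; congr commg_subgroup; apply: IH; lia.
set P := \big[_/_]_(_ <= _ < _) _.
have nF : {in index_iota 1 n.+2, forall s, is_normal
    (commg_subgroup (lazard_series s) (lazard_series (n.+2 - s)))}.
  by move=> s _; apply: normal_commg_subgroup; apply: normal_lazard_series.
have nP : is_normal P by apply: normal_prod.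
set Q := powg_subgroup _ _.
have nQ : is_normal Q by apply/normal_powg_subgroup/normal_lazard_series.
have QP : Q `<=` mulg_set Q P.
  by move=> x Qx; exists x => //; exists 1; [case: nP => -[] | rewrite mulg1].
have PP : P `<=` mulg_set Q P.
  by move=> x Px; exists 1; [case: nQ => -[] | exists x => //; rewrite mul1g].
have [sD _] := normal_lazard_series n.+2; have [_ DM _] := sD.
apply/seteqP; split=> [_ [x Qx [y Py <-]]|].
  apply: DM.
    apply: (gen_subset sD) Qx => _ [z Dz <-].
    by apply: lazard_series_antimono (ceil_le _) _ _; apply: lazard_series_qpow.
  apply: prod_subset Py => // s; rewrite mem_index_iota => /andP[s0 s_lt].
  apply: (gen_subset sD) => _ [u Du [v Dv <-]].
  by rewrite -(subnKC (ltnW s_lt)); apply: lazard_series_comm.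
apply: gen_subset; first by case: (normal_mulg_set nQ nP).
move=> _ [a [[|j] [x [a0 le_n gx ->]]]].
  (* Exponent [1]: the factor of index [s = n.+1] contains [gamma n.+2]. *)
  apply: PP; apply: (@subset_prod G _ _ n.+1 nF).
    by rewrite mem_index_iota ltnSn.
  have {}gx : gamma n.+2 x 
    by apply: lower_central_antimono gx; rewrite muln1 in le_n.
  move: gx; rewrite lower_centralS subSnn; apply: gen_subset.
    exact: is_subgroup_gen.
  move=> _ [u gu [v _ <-]]; apply: subset_gen; exists u.
    exact: lower_central_subset_lazard_series.
  by exists v => //; apply: lower_central_subset_lazard_series.
apply: QP; apply: subset_gen; exists (x ^+ (q ^ j)%N).
  apply: lazard_series_pow gx => //.
  rewrite /m /ceil_div -ltnS ltn_divLR //.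
  by move: le_n; rewrite expnSr; nia.
by rewrite -expgnA -expnSr.
Qed.

Lemma prod_eq_lazard_series n : 0 < n ->
  \mulg_(1 <= i < n.+1) powg_subgroup (gamma i) (zexp p q n i) =
  lazard_series n.
Proof.
move=> n0; have p1 := prime_gt1 p_prime.
have nF : {in index_iota 1 n.+1, forall i,
    is_normal (powg_subgroup (gamma i) (zexp p q n i))}.
  by move=> i _; apply/normal_powg_subgroup/normal_lower_central.
apply/seteqP; split.
  apply: prod_subset; first by case: (normal_lazard_series n).
  move=> i; rewrite mem_index_iota ltnS => lein.
  have [i0 _] := andP lein.
  have [k -> /(_ k)] := @zexpE p q n i p1 lein; rewrite leqnn => /esym le_n.
  apply: gen_subset; first by case: (normal_lazard_series n).
  by move=> _ [x gx <-]; apply: lazard_series_pow gx.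
apply: gen_subset; first by case: (normal_prod nF).
move=> _ [a [j [x [a0 le_n gx ->]]]].
(* Depths beyond [n] are absorbed by the factor at [i = n], of exponent [1]. *)
have [lt_na|le_an] := ltnP n a.
  apply: (@subset_prod G _ _ n nF); first by rewrite mem_index_iota n0 ltnSn.
  have [k -> /(_ 0%N)] := @zexpE p q n n p1 ltac:(by rewrite n0 leqnn).
  rewrite muln1 leqnn leqn0 => /eqP ->.
  apply: subset_gen; exists (x ^+ (q ^ j)%N); last by rewrite expn0 expg1.
  apply: subgroupX; first by case: (@normal_lower_central G n).
  exact: lower_central_antimono (ltnW lt_na) _ gx.
apply: (@subset_prod G _ _ a nF); first by rewrite mem_index_iota a0 ltnS.
have [k -> /(_ j)] := @zexpE p q n a p1 ltac:(by rewrite a0 le_an).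
rewrite le_n => le_kj; rewrite -(subnK le_kj) expnD expgnA.
apply: subset_gen; exists (x ^+ (q ^ (j - k))%N) => //.
by apply: subgroupX; first by case: (@normal_lower_central G a).
Qed.

End LazardSeries.

Unset Implicit Arguments.
Set Strict Implicit.

Theorem theorem8p3 (p t q : nat) (p_prime : prime p) (t_gt0 : 0 < t)
    (q_def : q = p ^ t) (G : groupType) (n : nat) (n_ge1 : 1 <= n) :
  zassenhaus G p q n =
  \mulg_(1 <= i < n.+1) powg_subgroup (lower_central G i) (zexp p q n i).
Proof.
by rewrite q_def zassenhaus_eq_lazard_series // prod_eq_lazard_series.
Qed.
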